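(* Let $\alpha,\beta$ be real parameters, $l_0\ge1$ and $n\ge0$ integers. Then the functions $P^{(1,l_0,n)}$ (with $n\ne l_0$), $P^{(2,l_0,n)}$, $P^{(3,l_0,n)}$, $P^{(4,l_0,n)}$ are polynomials in $z$ of degrees $$n+l_0-1,\qquad n+l_0,\qquad n+l_0,\qquad n+l_0+1,$$ respectively; for $n=l_0$ one has $P^{(1,l_0,l_0)}=0$.
   Context: Hendriksen-van Rossum polynomials: $P_n(z;a,b)=\frac{(b)_n}{(a+1)_n}\,{}_2F_1(-n,a+1;1-b-n;z)$, with $(a)_0=1$, $(a)_n=a(a+1)\cdots(a+n-1)$; the parameters are taken such that the expressions are defined. Write $P_n(z)=P_n(z;\alpha,\beta)$; a prime denotes $d/dz$. Define $$P^{(1,l_0,n)}(z)=P_{l_0}(z)P_n'(z)-P_{l_0}'(z)P_n(z),$$ $$P^{(2,l_0,n)}(z)=(1-z)\big(P_{l_0}(z;-\beta,-\alpha)P_n'(z)-P'_{l_0}(z;-\beta,-\alpha)P_n(z)\big)-(\alpha+\beta)P_{l_0}(z;-\beta,-\alpha)P_n(z),$$ $$P^{(3,l_0,n)}(z)=z^{l_0}\Big[z\big(P_{l_0}(z^{-1})P_n'(z)-(P_{l_0}(z^{-1}))'P_n(z)\big)+(1+\alpha)P_{l_0}(z^{-1})P_n(z)\Big],$$ $$P^{(4,l_0,n)}(z)=z^{l_0}\Big[z(z-1)\big(P_{l_0}(z^{-1};-\beta,-\alpha)P_n'(z)-(P_{l_0}(z^{-1};-\beta,-\alpha))'P_n(z)\big)-(1-\beta-(1+\alpha)z)P_{l_0}(z^{-1};-\beta,-\alpha)P_n(z)\Big],$$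 where $(P_{l_0}(z^{-1}))'$ means the $z$-derivative of the function $z\mapsto P_{l_0}(z^{-1})$, and similarly for $(P_{l_0}(z^{-1};-\beta,-\alpha))'$.
   Formalization: The degree n+l0 of P^(2,l0,n) is claimed only when α+β+n≠l0 (otherwise the leading coefficient l0−n−α−β vanishes, e.g. P^(2)=0 for α=1/2, β=−1/2, n=l0=1); the parameters are taken such that P_m(z;α,β) is defined for all m≥0. *)

(* Defs.v *)
From mathcomp Require Import all_boot all_order all_algebra.
From mathcomp Require Import all_classical topology normedtype derive.

Set Implicit Arguments.
Unset Strict Implicit.
Unset Printing Implicit Defensive.

Import Order.TTheory GRing.Theory Num.Theory.
Import numFieldNormedType.Exports.

Local Open Scope ring_scope.

(* z ranges over a numFieldType K, so that K may be a realType R (real z) or its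
   complexification R[i] (complex z); derive1 is then d/dz in K. *)

(* Rising factorial (x)_n = x (x + 1) ... (x + n - 1). *)
Definition poch (K : numFieldType) (x : K) (n : nat) : K :=
  \prod_(i < n) (x + i%:R).

(* The terminating series 2F1(-n, b; c; z): it is cut at k = n because
   (-n)_k = 0 for k > n, whatever the value of (c)_k. *)
Definition hyp2F1N (K : numFieldType) (n : nat) (b c z : K) : K :=
  \sum_(k < n.+1)
    poch (- n%:R) k * poch b k / (poch c k * (k`!)%:R) * z ^+ k.

Definition HvR (K : numFieldType) (n : nat) (a b : K) (z : K) : K :=
  poch b n / poch (a + 1) n * hyp2F1N n (a + 1) (1 - b - n%:R) z.

(* No denominator in HvR n a b vanishes. *)
Definition HvR_defined (K : numFieldType) (n : nat) (a b : K) : Prop :=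
  poch (a + 1) n != 0 /\
  forall k : nat, (k <= n)%N -> poch (1 - b - n%:R) k != 0.

Definition HvR1 (K : numFieldType) (a b : K) (l n : nat) (z : K) : K :=
  HvR l a b z * derive1 (HvR n a b) z - derive1 (HvR l a b) z * HvR n a b z.

Definition HvR2 (K : numFieldType) (a b : K) (l n : nat) (z : K) : K :=
  (1 - z) * (HvR l (- b) (- a) z * derive1 (HvR n a b) z
             - derive1 (HvR l (- b) (- a)) z * HvR n a b z)
  - (a + b) * HvR l (- b) (- a) z * HvR n a b z.

(* HvR3 and HvR4 are meaningful for z != 0 only: in MathComp 0^-1 = 0, so their
   values at 0 are junk. *)
Definition HvR3 (K : numFieldType) (a b : K) (l n : nat) (z : K) : K :=
  let g := fun w : K => HvR l a b w^-1 in
  z ^+ l * (z * (g z * derive1 (HvR n a b) z - derive1 g z * HvR n a b z)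
            + (1 + a) * g z * HvR n a b z).

Definition HvR4 (K : numFieldType) (a b : K) (l n : nat) (z : K) : K :=
  let g := fun w : K => HvR l (- b) (- a) w^-1 in
  z ^+ l * (z * (z - 1) * (g z * derive1 (HvR n a b) z - derive1 g z * HvR n a b z)
            - (1 - b - (1 + a) * z) * g z * HvR n a b z).

(* Main.v *)
Require Import Defs.
From mathcomp Require Import all_boot all_order all_algebra.
From mathcomp Require Import all_classical topology normedtype derive.
From mathcomp Require Import ring.

(** Each of the four functions is given explicitly as a polynomial whose top
    coefficient is read off from three facts: [P_n] is monic of degree [n], its
    constant coefficient [(b)_n / (a+1)_n] is nonzero, and the reciprocal
    polynomial [z^l p(1/z)] has [p(0)] as its coefficient of degree [l].
    The top coefficients are [n - l], [l - n - a - b], [c (n + 1 + a)] and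
    [d (n + 1 + a)], where [c], [d] are the constant coefficients of
    [P_l(z; a, b)] and [P_l(z; -b, -a)]. *)

Set Implicit Arguments.
Unset Strict Implicit.
Unset Printing Implicit Defensive.

Import Order.TTheory GRing.Theory Num.Theory.
Import numFieldNormedType.Exports.

Local Open Scope ring_scope.

Section TopCoefficient.
Variable R : comNzRingType.
Implicit Types (p q : {poly R}) (c d : R).

(* The coefficient [c] may vanish: [N] is only a bound for the degree. *)
Definition topcoef (N : nat) (c : R) (p : {poly R}) : Prop :=
  (size p <= N.+1)%N /\ p`_N = c.

Lemma topcoef_size N c p : topcoef N c p -> c != 0 -> size p = N.+1.
Proof.
move=> [le_p <-] nz; apply/eqP; rewrite eqn_leq le_p /=.
by rewrite ltnNge; apply: contra nz => /leq_sizeP ->.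
Qed.

Lemma topcoefC c : topcoef 0 c c%:P.
Proof. by split; [exact: size_polyC_leq1 | rewrite coefC]. Qed.

Lemma topcoefX : topcoef 1 1 ('X : {poly R}).
Proof. by split; [rewrite size_polyX | rewrite coefX]. Qed.

Lemma topcoefN N c p : topcoef N c p -> topcoef N (- c) (- p).
Proof. by move=> [sp cp]; split; rewrite ?size_polyN ?coefN ?cp. Qed.

Lemma topcoefD N c d p q :
  topcoef N c p -> topcoef N d q -> topcoef N (c + d) (p + q).
Proof.
move=> [sp cp] [sq cq]; split; last by rewrite coefD cp cq.
by rewrite (leq_trans (size_polyD _ _)) // geq_max sp sq.
Qed.

Lemma topcoefB N c d p q :
  topcoef N c p -> topcoef N d q -> topcoef N (c - d) (p - q).
Proof. by move=> tp tq; apply: topcoefD => //; apply: topcoefN. Qed.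

Lemma topcoefM M N c d p q :
  topcoef M c p -> topcoef N d q -> topcoef (M + N) (c * d) (p * q).
Proof.
move=> [sp cp] [sq cq]; split.
  apply: leq_trans (size_polyMleq _ _) _.
  by rewrite -subn1 leq_subLR add1n -addSn -addnS leq_add.
have le_M : (M < (M + N).+1)%N by rewrite ltnS leq_addr.
rewrite coefM (bigD1 (Ordinal le_M)) //= addKn cp cq big1 ?addr0 // => i.
rewrite -val_eqE /= neq_ltn => /orP[lt_iM | lt_Mi].
  have le_i : (N.+1 <= M + N - i)%N by rewrite ltn_subRL ltn_add2r.
  by rewrite [q`_ _]nth_default ?mulr0 // (leq_trans sq).
by rewrite nth_default ?mul0r // (leq_trans sp).
Qed.

(** The Euler operator z d/dz scales the coefficient of degree k by k, so it keeps the bound [N],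
    and [N = 0] needs no separate treatment. *)
Lemma topcoefXderiv N c p : topcoef N c p -> topcoef N (c *+ N) ('X * p^`()).
Proof.
move=> [sp cp]; split; last first.
  by rewrite coefXM coef_deriv -cp; case: N {sp cp} => [|N] /=.
apply/leq_sizeP => -[//|j] lt_Nj; rewrite coefXM coef_deriv /=.
by rewrite nth_default ?mul0rn // (leq_trans sp).
Qed.

(** Cancelling ['X] lowers the degree bound by one; the result is still stated at [N], with
    coefficient 0, so that it can be added to terms of bound [N]. *)
Lemma topcoef_divX N c p : topcoef N c ('X * p) -> topcoef N 0 p.
Proof.
move=> [/leq_sizeP sp _]; split; last first.
  by have := sp N.+1 (leqnn _); rewrite coefXM.
by apply/leq_sizeP => j le_j; have := sp j.+1 (leqW le_j); rewrite coefXM.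
Qed.

Definition recip_poly (l : nat) (p : {poly R}) : {poly R} :=
  \poly_(i < l.+1) p`_(l - i).

Lemma topcoef_recip l p : topcoef l p`_0 (recip_poly l p).
Proof. by split; [exact: size_poly | rewrite coef_poly leqnn subnn]. Qed.

End TopCoefficient.

Lemma horner_recip (F : fieldType) (l : nat) (p : {poly F}) (z : F) :
  (size p <= l.+1)%N -> z != 0 -> (recip_poly l p).[z] = z ^+ l * p.[z^-1].
Proof.
move=> sp nz; rewrite horner_poly (horner_coef_wide _ sp) mulr_sumr.
rewrite (reindex_inj rev_ord_inj) /=; apply: eq_bigr => i _.
have le_i : (i <= l)%N by rewrite -ltnS.
by rewrite !subSS subKn // expfB_cond ?(negbTE nz) // exprVn mulrCA.
Qed.

Section Derivative.
Variable K : numFieldType.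

(* The library's [is_derive_poly] is restricted to real fields. *)
Lemma is_derive_horner_comp (p : {poly K}) (f : K -> K) (x df : K) :
  is_derive x (1 : K) f df ->
  is_derive x (1 : K) (fun w => p.[f w]) (p^`().[f x] * df).
Proof.
move=> fdf; elim/poly_ind: p => [|p c IHp].
  have -> : (fun w => (0 : {poly K}).[f w]) = cst 0.
    by apply/funext => w; rewrite horner0.
  by rewrite deriv0 horner0 mul0r; exact: is_derive_cst.
have -> : (fun w => (p * 'X + c%:P).[f w]) = (fun w => p.[f w]) * f + cst c.
  by apply/funext => w; rewrite hornerMXaddC.
apply: is_derive_eq; rewrite derivMXaddC hornerD hornerMX /GRing.scale /=.
by ring.
Qed.

Lemma derive1_horner (p : {poly K}) : derive1 (horner p) = horner p^`().
Proof.
apply/funext => x; rewrite derive1E.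
have := is_derive_horner_comp p (is_derive_id x (1 : K)).
by rewrite mulr1 => /@derive_val.
Qed.

Lemma derive1_hornerV (p : {poly K}) (z : K) : z != 0 ->
  derive1 (fun w => p.[w^-1]) z = - (p^`().[z^-1] * z ^- 2).
Proof.
move=> nz; rewrite derive1E.
have dV : is_derive z (1 : K) (fun w : K => w^-1) (- z ^- 2).
  apply: DeriveDef; first exact: (@derivableV _ _ id).
  by rewrite (@deriveV _ _ id) // derive_id /GRing.scale /= mulr1.
by rewrite -mulrN; have /@derive_val := is_derive_horner_comp p dV.
Qed.

End Derivative.

Section HendriksenVanRossum.
Variable K : numFieldType.
Implicit Types a b : K.

(** Reversing the order of the factors turns the factor of index i into -(b + i). *)
Lemma poch_reflect b n : poch (1 - b - n%:R) n = (-1) ^+ n * poch b n.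
Proof.
rewrite /poch (reindex_inj rev_ord_inj) /=.
rewrite -[n in (-1) ^+ n]card_ord -prodrN; apply: eq_bigr => i _.
by rewrite natrB // -natr1; ring.
Qed.

Lemma poch1 n : poch (1 : K) n = n`!%:R.
Proof.
elim: n => [|n IHn]; first by rewrite /poch big_ord0.
by rewrite /poch big_ord_recr /= [X in X * _]IHn factS natrM mulrC -natr1 addrC.
Qed.

Lemma pochS a n : poch a n.+1 = poch a n * (a + n%:R).
Proof. by rewrite /poch big_ord_recr. Qed.

Definition HvR_poly (n : nat) a b : {poly K} :=
  \poly_(k < n.+1) (poch b n / poch (a + 1) n *
    (poch (- n%:R) k * poch (a + 1) k / (poch (1 - b - n%:R) k * k`!%:R))).

Lemma HvR_horner n a b : HvR n a b = horner (HvR_poly n a b).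
Proof.
apply/funext => z; rewrite /HvR /hyp2F1N horner_poly mulr_sumr.
by apply: eq_bigr => i _; rewrite mulrA.
Qed.

(** Up to sign, [poch b n] is the Pochhammer denominator of the term k = n. *)
Lemma HvR_defined_poch_neq0 n a b : HvR_defined n a b -> poch b n != 0.
Proof.
move=> [_ /(_ n (leqnn n))]; rewrite poch_reflect.
by rewrite mulf_eq0 signr_eq0.
Qed.

(** Reflection gives (1-b-n)_n = (-1)^n (b)_n and, at b = 1, (-n)_n = (-1)^n n!; with these every
    factor of the coefficient of index n cancels. *)
Lemma topcoef_HvR n a b : HvR_defined n a b -> topcoef n 1 (HvR_poly n a b).
Proof.
move=> def; have nzb := HvR_defined_poch_neq0 def; case: def => nza _.
split; first exact: size_poly.
have poch_opp : poch (- n%:R) n = (-1) ^+ n * n`!%:R :> K.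
  by rewrite -poch1 -poch_reflect subrr sub0r.
rewrite coef_poly ltnSn poch_opp poch_reflect.
have nzs : (-1) ^+ n != 0 :> K by rewrite signr_eq0.
have nzf : n`!%:R != 0 :> K by rewrite pnatr_eq0 -lt0n fact_gt0.
by field; rewrite nza nzf nzb nzs.
Qed.

Lemma HvR_coef0_neq0 n a b : HvR_defined n a b -> (HvR_poly n a b)`_0 != 0.
Proof.
move=> def; have nzb := HvR_defined_poch_neq0 def; case: def => nza _.
(* The selected occurrences are the empty products of index 0. *)
rewrite coef_poly /= {3 4 5}/poch !big_ord0 fact0 !mulr1 divr1 mulr1.
by rewrite mulf_neq0 ?invr_eq0.
Qed.

End HendriksenVanRossum.

Theorem mainTheorem2 (K : numFieldType) (alpha beta : K) (l0 n : nat)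
    (alpha_real : alpha \is Num.real) (beta_real : beta \is Num.real)
    (l0_ge1 : (1 <= l0)%N)
    (HvR_def : forall m : nat, HvR_defined m alpha beta) :
  (n <> l0 ->
    exists p : {poly K}, size p = (n + l0 - 1).+1 /\
      forall z : K, HvR1 alpha beta l0 n z = p.[z]) /\
  (n = l0 -> forall z : K, HvR1 alpha beta l0 n z = 0) /\
  (HvR_defined l0 (- beta) (- alpha) ->
    exists p : {poly K},
      (alpha + beta + n%:R != l0%:R -> size p = (n + l0).+1) /\
      forall z : K, HvR2 alpha beta l0 n z = p.[z]) /\
  (exists p : {poly K}, size p = (n + l0).+1 /\
      forall z : K, z != 0 -> HvR3 alpha beta l0 n z = p.[z]) /\
  (HvR_defined l0 (- beta) (- alpha) ->
    exists p : {poly K}, size p = (n + l0 + 1).+1 /\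
      forall z : K, z != 0 -> HvR4 alpha beta l0 n z = p.[z]).
Proof.
have tP := topcoef_HvR (HvR_def n).
have tXP := topcoefXderiv tP.
set P := HvR_poly n alpha beta in tP tXP.
(* The factor ['X] turns both derivatives into Euler operators. Here [q] stands for either companion
   of degree [l0], as both are monic. *)
have tXWronskian (q : {poly K}) : topcoef l0 1 q ->
    topcoef (n + l0) (n%:R - l0%:R) ('X * (q * P^`() - q^`() * P)).
  move=> tq; have -> : 'X * (q * P^`() - q^`() * P) =
      'X * P^`() * q - P * ('X * q^`()) by ring.
  have := topcoefB (topcoefM tXP tq) (topcoefM tP (topcoefXderiv tq)).
  by rewrite mulr1 mul1r.
(* This is the last factor of (alpha+1)_{n+1}, a denominator of the polynomial of index n + 1. *)
have nz_an : n%:R + (1 + alpha) != 0.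
  have [+ _] := HvR_def n.+1; rewrite pochS mulf_eq0 negb_or => /andP[_].
  by rewrite addrC [alpha + 1]addrC.
(* The Euler derivative has no constant term, so its reversal contributes nothing in degree [l0]. *)
have tRecip (q : {poly K}) : topcoef l0 0 (recip_poly l0 ('X * q^`())).
  by have := topcoef_recip l0 ('X * q^`()); rewrite coefXM.
(* Since z d/dz q(1/z) = -(1/z) q'(1/z), the second reversal represents the derivative of z ->
   q(1/z), with opposite sign. *)
have horner_recips (q : {poly K}) (z : K) : topcoef l0 1 q -> z != 0 ->
    (recip_poly l0 q).[z] = z ^+ l0 * q.[z^-1] /\
    (recip_poly l0 ('X * q^`())).[z] = z ^+ l0 * (z^-1 * q^`().[z^-1]).
  move=> tq nz; split; first by apply: horner_recip => //; case: tq.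
  by rewrite horner_recip ?hornerM ?hornerX //; case: (topcoefXderiv tq).
pose hornerRing := (hornerD, hornerN, hornerM, hornerC, hornerX).
split=> [neq_nl|].
  have tQ := topcoef_HvR (HvR_def l0).
  set Q := HvR_poly l0 alpha beta in tQ.
  exists (Q * P^`() - Q^`() * P); split; last first.
    by move=> z; rewrite /HvR1 !HvR_horner !derive1_horner !hornerE.
  have /topcoef_size := tXWronskian _ tQ.
  rewrite subr_eq0 eqr_nat => /(_ (introN eqP neq_nl)) sXW.
  have nzW : Q * P^`() - Q^`() * P != 0.
    by apply: contra_eq_neq sXW => ->; rewrite mulr0 size_poly0.
  move: sXW; rewrite size_mul ?polyX_eq0 // size_polyX add2n /= => -[->].
  (* The subtraction is truncated: [l0_ge1] makes n + l0 positive. *)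
  by rewrite subn1 prednK // addn_gt0 l0_ge1 orbT.
split=> [-> z|]; first by rewrite /HvR1 mulrC subrr.
split=> [def|].
  have tQ := topcoef_HvR def.
  set Q := HvR_poly l0 (- beta) (- alpha) in tQ.
  set W := Q * P^`() - Q^`() * P.
  (* In degree n + l0 the three terms contribute 0, -(n - l0) and -(alpha + beta). *)
  exists (W - 'X * W - (alpha + beta)%:P * (P * Q)); split=> [neq|z]; last first.
    by rewrite /HvR2 !HvR_horner !derive1_horner !hornerRing -/P -/Q; ring.
  have tXW := tXWronskian _ tQ.
  have tPQ := topcoefM (topcoefC (alpha + beta)) (topcoefM tP tQ).
  apply: topcoef_size (topcoefB (topcoefB (topcoef_divX tXW) tXW) tPQ) _.
  apply: contra neq => /eqP top0; rewrite -subr_eq0; apply/eqP.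
  by rewrite -[RHS]oppr0 -top0; ring.
split=> [|def].
  have tQ := topcoef_HvR (HvR_def l0).
  have nzQ := HvR_coef0_neq0 (HvR_def l0).
  set Q := HvR_poly l0 alpha beta in tQ nzQ.
  exists ('X * P^`() * recip_poly l0 Q + P * recip_poly l0 ('X * Q^`())
          + (1 + alpha)%:P * (P * recip_poly l0 Q)).
  split=> [|z nz]; last first.
    have [hQ hQ'] := horner_recips _ _ tQ nz.
    rewrite /HvR3 !HvR_horner derive1_horner derive1_hornerV // !hornerRing hQ hQ'.
    by rewrite -/P -/Q; field.
  have tR := topcoef_recip l0 Q.
  apply: topcoef_size (topcoefD (topcoefD (topcoefM tXP tR)
    (topcoefM tP (tRecip Q))) (topcoefM (topcoefC _) (topcoefM tP tR))) _.
  by rewrite mulr0 addr0 mul1r -mulrDl mulf_neq0.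
have tQ := topcoef_HvR def.
have nzQ := HvR_coef0_neq0 def.
set Q := HvR_poly l0 (- beta) (- alpha) in tQ nzQ.
exists (('X - 1%:P) * ('X * P^`() * recip_poly l0 Q
                       + P * recip_poly l0 ('X * Q^`()))
        - ((1 - beta)%:P - 'X * (1 + alpha)%:P) * (P * recip_poly l0 Q)).
split=> [|z nz]; last first.
  have [hQ hQ'] := horner_recips _ _ tQ nz.
  rewrite /HvR4 !HvR_horner derive1_horner derive1_hornerV // !hornerRing hQ hQ'.
  by rewrite -/P -/Q; field.
have tR := topcoef_recip l0 Q.
(* Constants are given the bound 1 so that they combine with ['X] in the two linear factors. *)
have tC c : topcoef 1 0 (c%:P : {poly K}).
  by split; [rewrite (leq_trans (size_polyC_leq1 _)) | rewrite coefC].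
rewrite addnC; apply: topcoef_size (topcoefB (topcoefM
  (topcoefB (topcoefX _) (tC 1)) (topcoefD (topcoefM tXP tR)
    (topcoefM tP (tRecip Q)))) (topcoefM (topcoefB (tC _)
      (topcoefM (topcoefX _) (topcoefC _))) (topcoefM tP tR))) _.
(* With d the constant coefficient of [Q], the top coefficient is n d + (1 + alpha) d. *)
rewrite mulr0 addr0 !subr0 sub0r !mul1r mulNr opprK -mulrDl.
by rewrite mulf_neq0.
Qed.
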